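(* Let $V$ be a real Hilbert space of dimension at least $2$, and consider the group $G:=\{\pm\operatorname{id}\}\leq O(V)$. Then $c_2(V/G)=\sqrt{2}$.
   Context: $V/G$ is the set of orbits $[x]=\{x,-x\}$, $x\in V$, with metric $d([x],[y])=\min\{\|x-y\|,\|x+y\|\}$. The Euclidean distortion $c_2(X)\in[1,\infty]$ of a metric space $X$ is the infimum of all $c$ for which there exist a Hilbert space $H$, a map $f\colon X\to H$ and a constant $\alpha>0$ such that $\alpha\, d_X(x,x')\leq\|f(x)-f(x')\|\leq c\,\alpha\, d_X(x,x')$ for all $x,x'\in X$ (that is, $f$ is bilipschitz of distortion at most $c$, where distortion is the ratio of the optimal upper to lower Lipschitz bounds). *)

(* Defs.v *)
From HB Require Import structures.
From mathcomp Require Import all_boot all_order all_algebra generic_quotient.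
From mathcomp Require Import all_classical all_reals all_analysis.

Set Implicit Arguments.
Unset Strict Implicit.
Unset Printing Implicit Defensive.
Import Order.TTheory GRing.Theory Num.Theory.
Import numFieldNormedType.Exports.
Local Open Scope classical_set_scope.
Local Open Scope ring_scope.
Local Open Scope quotient_scope.

(* A real Hilbert space: a complete normed space whose norm is induced by a
   positive definite symmetric bilinear form. *)
HB.mixin Record CompleteNormedModule_isHilbert (R : realType) V
    & CompleteNormedModule R V := {
  inner : {dot V for (@idfun R)} ;
  inner_norm : forall x : V, inner x x = `|x| ^+ 2
}.

#[short(type="hilbertType")]
HB.structure Definition Hilbert (R : realType) :=
  {V of CompleteNormedModule R V & CompleteNormedModule_isHilbert R V}.

(* [V] may be infinite-dimensional, so its dimension is bounded below by
   exhibiting [n] linearly independent vectors. *)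
Definition dim_ge (n : nat) (R : realType) (V : lmodType R) : Prop :=
  exists e : 'I_n -> V, forall a : 'I_n -> R,
    \sum_i a i *: e i = 0 -> forall i, a i = 0.

Section SignQuotient.
Context {R : realType} (V : hilbertType R).

(* The orbit of [x] under {id, -id}. *)
Definition sign_orbit (x : V) : seq V := [:: x; - x].

Definition sign_rel : rel V := fun x y => y \in sign_orbit x.

Lemma sign_relP x y : reflect (y = x \/ y = - x) (sign_rel x y).
Proof. by rewrite /sign_rel !inE; apply: (iffP pred2P). Qed.

Lemma sign_rel_equiv : equiv_class_of sign_rel.
Proof.
split=> [x|x y|y x z]; first by apply/sign_relP; left.
  by apply/idP/idP => /sign_relP[->|->]; apply/sign_relP; rewrite ?opprK; auto.
by move=> /sign_relP[->|->] /sign_relP[->|->]; apply/sign_relP;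
  rewrite ?opprK; auto.
Qed.

Canonical sign_equiv := EquivRelPack sign_rel_equiv.

Definition sign_quotient := {eq_quot sign_equiv}.

HB.instance Definition _ := Choice.on sign_quotient.
HB.instance Definition _ := EqQuotient.on sign_quotient.

(* [repr] picks a point of each orbit; [sign_distE] below shows that the
   distance does not depend on this choice. *)
Definition sign_dist (p q : sign_quotient) : R :=
  Num.min `|repr p - repr q| `|repr p + repr q|.

Lemma repr_sign (x : V) :
  repr (\pi_(sign_quotient) x) = x \/ repr (\pi_(sign_quotient) x) = - x.
Proof.
have : \pi_(sign_quotient) x = \pi_(sign_quotient) (repr (\pi_(sign_quotient) x)) by rewrite reprK.
by move/eqquotP/sign_relP.
Qed.

Lemma sign_distE (x y : V) :
  sign_dist (\pi_(sign_quotient) x) (\pi_(sign_quotient) y) =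
  Num.min `|x - y| `|x + y|.
Proof.
rewrite /sign_dist; case: (repr_sign x) => ->; case: (repr_sign y) => -> //.
- by rewrite opprK minC.
- by rewrite -opprD normrN minC addrC distrC.
- by rewrite opprK -opprD normrN addrC distrC.
Qed.

Lemma sign_distxx p : sign_dist p p = 0.
Proof.
elim/quotW: p => x.
by rewrite sign_distE subrr normr0 min_l.
Qed.

Lemma sign_dist_eq0 p q : sign_dist p q = 0 -> p = q.
Proof.
elim/quotW: p => x; elim/quotW: q => y; rewrite sign_distE.
move=> d0; apply/eqquotP/sign_relP; move: d0.
rewrite minEle; case: ifP => _ /normr0_eq0/eqP.
  by rewrite subr_eq0 => /eqP ->; left.
by rewrite addrC addr_eq0 => /eqP ->; right.
Qed.

Lemma sign_distC p q : sign_dist p q = sign_dist q p.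
Proof. by rewrite /sign_dist distrC [repr q + repr p]addrC. Qed.

Lemma sign_dist_triangle q p r :
  sign_dist p r <= sign_dist p q + sign_dist q r.
Proof.
elim/quotW: p => x; elim/quotW: q => y; elim/quotW: r => z.
rewrite !sign_distE ge_min.
have n1 : `|x - z| <= `|x - y| + `|y - z| by exact: ler_distD.
have n2 : `|x + z| <= `|x - y| + `|y + z|.
  by have := ler_distD y x (- z); rewrite !opprK.
have n3 : `|x + z| <= `|x + y| + `|y - z|.
  have := ler_normD (x + y) (z - y).
  by rewrite [x + y + _]addrACA subrr addr0 (distrC z).
have n4 : `|x - z| <= `|x + y| + `|y + z|.
  have := ler_normB (x + y) (z + y).
  by rewrite opprD addrACA subrr addr0 [z + y]addrC.
by case: (leP `|x - y|) => _; case: (leP `|y - z|) => _;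
  rewrite ?n1 ?n2 ?n3 ?n4 ?orbT.
Qed.

HB.instance Definition _ := isMetric.Build R sign_quotient
  sign_distxx sign_dist_eq0 sign_distC sign_dist_triangle.

Lemma mdist_sign_quotient (x y : V) :
  mdist (\pi_(sign_quotient) x) (\pi_(sign_quotient) y) =
  Num.min `|x - y| `|x + y|.
Proof. exact: sign_distE. Qed.

End SignQuotient.

Definition has_distortion_le (R : realType) (X : metricType R)
    (H : hilbertType R) (f : X -> H) (c : R) : Prop :=
  exists2 alpha : R, 0 < alpha &
    forall x x' : X,
      alpha * mdist x x' <= `|f x - f x'| <= c * alpha * mdist x x'.

(* The restriction [1 <= c] is automatic when [X] has two distinct points; it
   gives one-point spaces distortion 1. The infimum is +oo when there is no
   bilipschitz embedding into a Hilbert space. *)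
Definition euclidean_distortion (R : realType) (X : metricType R) : \bar R :=
  ereal_inf [set c%:E | c in [set c : R | 1 <= c /\
    exists (H : hilbertType R) (f : X -> H), has_distortion_le f c]].

(* Main.v *)
(* Upper bound: the normalised Veronese map f(x) = x (x) x / |x| satisfies
   |f(x) - f(y)|^2 = |x|^2 + |y|^2 - 2 <x,y>^2 / (|x| |y|), which lies between
   d^2 and 2 d^2, where d^2 = |x|^2 + |y|^2 - 2 |<x,y>|. Instead of a Hilbert
   tensor product, the target is the Hilbert space generated by the positive
   semidefinite kernel <x,y>^2 / (|x| |y|).

   Lower bound: the unit circle of a plane in V becomes a circle of length pi in
   V/G. Take 2n equally spaced points on it, with images f_j under an embedding.
   The sequence g_j = f_j - f_{j+n} is antiperiodic, so the sharp discrete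
   Wirtinger inequality 2 (1 - cos (pi/n)) sum |g_j|^2 <= sum |g_{j+1} - g_j|^2
   holds. Bounding |g_j| below by the distance sqrt 2 of antipodal points and
   |g_{j+1} - g_j| above by two steps gives 1 + cos (pi/2n) <= c^2; now let n go
   to infinity along powers of 2, for which the Wirtinger inequality follows
   from the angle-halving formula. *)
From HB Require Import structures.
Require Import Defs.
From mathcomp Require Import all_boot all_order all_algebra.
From mathcomp Require Import all_classical all_reals all_analysis.
From mathcomp Require Import ring lra.
Import Order.TTheory GRing.Theory Num.Theory.
Import numFieldNormedType.Exports.
Set Implicit Arguments.
Unset Strict Implicit.
Unset Printing Implicit Defensive.
Local Open Scope classical_set_scope.
Local Open Scope ring_scope.

(** * Positive semidefinite forms and their Cauchy--Schwarz inequality *)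

(* The carrier need not be a vector space: its elements (formal linear
   combinations, in the application) only matter through the form. *)
Record prehilbert (R : realType) := Prehilbert {
  pre_sort :> Type;
  pre_form : pre_sort -> pre_sort -> R;
  pre_zero : pre_sort;
  pre_comb : R -> pre_sort -> pre_sort -> pre_sort;
  pre_form0 : forall q, pre_form pre_zero q = 0;
  pre_form_comb : forall a p q r,
    pre_form (pre_comb a p q) r = a * pre_form p r + pre_form q r;
  pre_formC : forall p q, pre_form p q = pre_form q p;
  pre_form_ge0 : forall p, 0 <= pre_form p p }.

Section Prehilbert.
Context {R : realType} {P : prehilbert R}.
Local Notation B := (@pre_form R P).

Definition pre_norm (p : P) : R := Num.sqrt (B p p).

Lemma pre_norm_ge0 p : 0 <= pre_norm p.
Proof. exact: sqrtr_ge0. Qed.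

Lemma sqr_pre_norm p : pre_norm p ^+ 2 = B p p.
Proof. by rewrite sqr_sqrtr // pre_form_ge0. Qed.

Lemma pre_form0r q : B q (pre_zero P) = 0.
Proof. by rewrite pre_formC pre_form0. Qed.

Lemma pre_form_combr a p q r : B r (pre_comb a p q) = a * B r p + B r q.
Proof. by rewrite pre_formC pre_form_comb !(pre_formC r). Qed.

Lemma pre_form_CauchySchwarz p q : `|B p q| <= pre_norm p * pre_norm q.
Proof.
have E a b x y : B (pre_comb a x (pre_comb b y (pre_zero P)))
    (pre_comb a x (pre_comb b y (pre_zero P))) =
    a ^+ 2 * B x x + 2 * a * b * B x y + b ^+ 2 * B y y.
  rewrite !pre_form_comb !pre_form_combr !pre_form0 !pre_form0r.
  by rewrite (pre_formC y x); ring.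
have H a b : 0 <= a ^+ 2 * B p p + 2 * a * b * B p q + b ^+ 2 * B q q.
  by rewrite -E pre_form_ge0.
rewrite -(@ler_pXn2r _ 2) ?nnegrE ?mulr_ge0 ?pre_norm_ge0 // exprMn.
rewrite !sqr_pre_norm real_normK ?num_real //.
have pp := pre_form_ge0 p; have qq := pre_form_ge0 q.
have [pp0|pp0] := eqVneq (B p p) 0; last first.
  (* These coefficients turn the quadratic form into [B p p * (B p p * B q q - B p q ^+ 2)], so a
     positive factor cancels. *)
  have := H (- B p q) (B p p); have : 0 < B p p by rewrite lt_neqAle eq_sym pp0.
  by nra.
(* With [B p p = 0] the form equals [- (B q q + 2) * B p q ^+ 2], which forces [B p q = 0]. *)
by have := H (- (B q q + 1)) (B p q); rewrite pp0; nra.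
Qed.

Definition approximable : {pred P -> R} := [pred u : P -> R |
  `[< forall e, 0 < e ->
      exists p, forall q, `|u q - B p q| <= e * pre_norm q >]].

Lemma approximable_submod_closed : submod_closed approximable.
Proof.
split.
  apply/asboolP => e e0; exists (pre_zero P) => q.
  by rewrite pre_form0 subrr normr0 mulr_ge0 ?pre_norm_ge0 ?ltW.
move=> a u v /asboolP ua /asboolP va; apply/asboolP => e e0.
(* The added 1 keeps the divisor positive when [a = 0]. *)
have a1 : 0 < `|a| + 1 by rewrite ltr_wpDl.
have e1 : 0 < e / 2 / (`|a| + 1) by rewrite !divr_gt0.
have [p Hp] := ua _ e1; have [p' Hp'] := va _ (divr_gt0 e0 (ltr0Sn _ 1)).
exists (pre_comb a p p') => q; rewrite pre_form_comb.
have -> : (a *: u + v) q - (a * B p q + B p' q) =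
  a * (u q - B p q) + (v q - B p' q).
  by change ((a *: u + v) q) with (a * u q + v q); ring.
apply: le_trans (ler_normD _ _) _; rewrite normrM.
have := Hp' q; have : `|a| * `|u q - B p q| <= e / 2 * pre_norm q.
  have -> : e / 2 * pre_norm q = (`|a| + 1) * (e / 2 / (`|a| + 1) * pre_norm q).
    by field; rewrite gt_eqF.
  by apply: ler_pM => //; rewrite lerDl.
by lra.
Qed.
HB.instance Definition _ := GRing.isSubmodClosed.Build R (P -> R) approximable
  approximable_submod_closed.

End Prehilbert.

(** * Hilbert completion of a semidefinite form *)

Section Completion.
Context (R : realType) (P : prehilbert R).
Local Notation B := (@pre_form R P).

(* The completion, realised inside the algebraic dual: the functionals which
   are limits, in dual norm, of functionals [B p]. *)
Record completion := Completion {
  functional :> P -> R;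
  functionalP : functional \in @approximable R P }.

HB.instance Definition _ := [isSub for functional].
HB.instance Definition _ := [Choice of completion by <:].
HB.instance Definition _ := [SubChoice_isSubLmodule of completion by <:].
End Completion.

Section CompletionNorm.
Context (R : realType) (P : prehilbert R).
Local Notation B := (@pre_form R P).
Local Notation H := (completion P).

Lemma functionalB (x y : H) q : (x - y) q = x q - y q.
Proof. by []. Qed.

Lemma pre_form_approximable p : B p \in @approximable R P.
Proof.
apply/asboolP => e e0; exists p => q.
by rewrite subrr normr0 mulr_ge0 ?pre_norm_ge0 ?ltW.
Qed.

Definition embed (p : P) : H := Completion (pre_form_approximable p).

(** Where [pre_norm q = 0] the quotient is 0 by the convention on inverses; nothing is lost, since
    [x q] vanishes there by [functional_bounded]. *)
Definition dual_norm (x : H) : R :=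
  sup (range (fun q => `|x q| / pre_norm q)).

Lemma functional_bounded (x : H) :
  exists2 C, 0 <= C & forall q, `|x q| <= C * pre_norm q.
Proof.
have /asboolP/(_ 1 ltr01) [p Hp] := functionalP x.
exists (1 + pre_norm p) => [|q]; first by rewrite addr_ge0 ?pre_norm_ge0.
rewrite -(subrK (B p q) (x q)); apply: le_trans (ler_normD _ _) _.
by rewrite mulrDl lerD ?Hp ?pre_form_CauchySchwarz.
Qed.

Lemma ratio_le_bound (x : H) C q : 0 <= C ->
  `|x q| <= C * pre_norm q -> `|x q| / pre_norm q <= C.
Proof.
move=> C0; have := pre_norm_ge0 q; rewrite le_eqVlt => /predU1P[<- _|q0 xq].
  by rewrite invr0 mulr0.
by rewrite ler_pdivrMr.
Qed.

Lemma dual_norm_ge (x : H) q : `|x q| <= dual_norm x * pre_norm q.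
Proof.
have [C C0 HC] := functional_bounded x.
have := pre_norm_ge0 q; rewrite le_eqVlt => /predU1P[q0|q0].
  by have := HC q; rewrite -q0 !mulr0.
rewrite -ler_pdivrMr //; apply: ub_le_sup; last by exists q.
by exists C => _ [r _ <-]; exact: ratio_le_bound.
Qed.

Lemma dual_norm_le (x : H) C : 0 <= C ->
  (forall q, `|x q| <= C * pre_norm q) -> dual_norm x <= C.
Proof.
move=> C0 HC; apply: ge_sup; last by move=> _ [r _ <-]; exact: ratio_le_bound.
by exists (`|x (pre_zero P)| / pre_norm (pre_zero P)), (pre_zero P).
Qed.

Lemma dual_norm_ge0 (x : H) : 0 <= dual_norm x.
Proof.
have [C C0 HC] := functional_bounded x.
apply: (@le_trans _ _ (`|x (pre_zero P)| / pre_norm (pre_zero P))).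
  by rewrite divr_ge0 ?pre_norm_ge0.
apply: ub_le_sup; last by exists (pre_zero P).
by exists C => _ [r _ <-]; exact: ratio_le_bound.
Qed.

Lemma dual_normD (x y : H) : dual_norm (x + y) <= dual_norm x + dual_norm y.
Proof.
apply: dual_norm_le => [|q]; first by rewrite addr_ge0 ?dual_norm_ge0.
rewrite mulrDl; apply: le_trans (ler_normD _ _) _.
by rewrite lerD ?dual_norm_ge.
Qed.

Lemma dual_normZ (a : R) (x : H) : dual_norm (a *: x) = `|a| * dual_norm x.
Proof.
have le b y : dual_norm (b *: y) <= `|b| * dual_norm y.
  apply: dual_norm_le => [|q]; first by rewrite mulr_ge0 ?dual_norm_ge0.
  by rewrite normrM -mulrA ler_wpM2l ?dual_norm_ge.
apply/eqP; rewrite eq_le le /=.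
have [->|a0] := eqVneq a 0; first by rewrite normr0 mul0r dual_norm_ge0.
rewrite -ler_pdivlMl ?normr_gt0 // -normfV.
by have := le a^-1 (a *: x); rewrite scalerA mulVf // scale1r.
Qed.

Lemma dual_norm_eq0 (x : H) : dual_norm x = 0 -> x = 0.
Proof.
move=> x0; apply/val_inj/funext => q /=; apply/eqP.
by rewrite -normr_le0; have := dual_norm_ge x q; rewrite x0 mul0r.
Qed.

HB.instance Definition _ := Lmodule_isNormed.Build R H
  dual_normD dual_normZ dual_norm_eq0.

Lemma norm_functional_le (x : H) q : `|x q| <= `|x| * pre_norm q.
Proof. exact: dual_norm_ge. Qed.

Lemma norm_completion_le (x : H) C : 0 <= C ->
  (forall q, `|x q| <= C * pre_norm q) -> `|x| <= C.
Proof. exact: dual_norm_le. Qed.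

Lemma embed_dense (x : H) e : 0 < e -> exists p, `|x - embed p| <= e.
Proof.
move=> e0; have /asboolP/(_ _ e0) [p Hp] := functionalP x; exists p.
by apply: norm_completion_le => //; exact: ltW.
Qed.

(** Cauchy--Schwarz bounds the dual norm from above, and evaluating [B p] at [p] itself attains the
    bound. *)
Lemma norm_embed p : `|embed p| = pre_norm p.
Proof.
apply/le_anti/andP; split.
  apply: norm_completion_le => [|q]; first exact: pre_norm_ge0.
  exact: pre_form_CauchySchwarz.
have [->//|p0] := eqVneq (pre_norm p) 0.
have {}p0 : 0 < pre_norm p by rewrite lt_neqAle eq_sym p0 pre_norm_ge0.
rewrite -(ler_pM2r p0); apply: le_trans (norm_functional_le _ _).
by rewrite -expr2 sqr_pre_norm ler_norm.
Qed.

(** Evaluation at [q] is Lipschitz with constant [pre_norm q], so [F] converges pointwise to some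
    [u]. The Cauchy estimates are uniform relative to [pre_norm] and survive the limit; hence [u] is
    again approximable, and it is the limit in norm. *)
Lemma completion_complete (F : set_system H) : ProperFilter F ->
  cauchy F -> cvg F.
Proof.
move=> FF /cauchyP Fc.
have close e : 0 < e -> exists x : H, F [set y | `|x - y| <= e].
  move=> e0; have [x Fx] := Fc _ e0; exists x; apply: filterS Fx => y.
  by rewrite -ball_normE /=; exact: ltW.
have limq q : cvg ((fun x : H => x q) @ F).
  apply: cauchy_cvg; apply: cauchy_exP => e e0.
  have q1 : 0 < pre_norm q + 1 by rewrite ltr_wpDl ?pre_norm_ge0.
  have [x Fx] := close _ (divr_gt0 e0 q1).
  exists (x q); change (F [set y : H | ball (x q) e (y q)]).
  apply: filterS Fx => y /= xy.
  rewrite -ball_normE /=.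
  apply: le_lt_trans (norm_functional_le (x - y) q) _.
  apply: le_lt_trans (ler_wpM2r (pre_norm_ge0 q) xy) _.
  by rewrite -mulrA gtr_pMr // ltr_pdivrMl // mulr1 ltrDl.
pose u q := lim ((fun x : H => x q) @ F).
have ux e (x : H) : F [set y | `|x - y| <= e] ->
    forall q, `|x q - u q| <= e * pre_norm q.
  move=> Fx q.
  have cx : (fun y : H => `|x q - y q|) @ F --> `|x q - u q|.
    by apply: cvg_norm; apply: cvgB; [exact: cvg_cst | exact: limq].
  have := cvg_lim (@Rhausdorff R) cx => <-.
  apply: limr_le; first by apply/cvg_ex; eexists; exact: cx.
  near=> y; apply: le_trans (norm_functional_le (x - y) q) _.
  by apply: ler_wpM2r; [exact: pre_norm_ge0 | near: y].
have uP : u \in @approximable R P.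
  apply/asboolP => e e0; have e2 : 0 < e / 2 by rewrite divr_gt0.
  have [x Fx] := close _ e2; have [p xp] := embed_dense x e2; exists p => q.
  have := ux _ _ Fx q; rewrite distrC.
  have := le_trans (norm_functional_le (x - embed p) q)
    (ler_wpM2r (pre_norm_ge0 q) xp).
  rewrite functionalB /=; have := ler_distD (x q) (u q) (B p q); lra.
apply/cvg_ex; exists (Completion uP); apply/cvgrPdist_le => e e0.
have e2 : 0 < e / 2 by rewrite divr_gt0.
have [x Fx] := close _ e2; near=> y.
have xy : `|x - y| <= e / 2 by near: y.
have xu : `|x - Completion uP| <= e / 2.
  by apply: norm_completion_le; [exact: ltW | exact: ux].
have := ler_distD x (Completion uP) y; rewrite (distrC _ x); lra.
Unshelve. all: by end_near. Qed.

HB.instance Definition _ := Uniform_isComplete.Build H completion_complete.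

End CompletionNorm.

Section CompletionInner.
Context (R : realType) (P : prehilbert R).
Local Notation B := (@pre_form R P).
Local Notation H := (completion P).

Lemma embed_comb (a : R) (p q : P) :
  embed (pre_comb a p q) = a *: embed p + embed q.
Proof. by apply/val_inj/funext => r; rewrite /= pre_form_comb. Qed.

Lemma embed_cvg (x : H) :
  exists p : nat -> P, (embed (p n) : H) @[n --> \oo] --> x.
Proof.
have near_x n : exists p, `|x - embed p| <= n.+1%:R^-1 by exact: embed_dense.
have [p Hp] := choice near_x; exists p; apply/cvgrPdist_le => e e0.
near=> n; apply: le_trans (Hp n) (ltW _).
by near: n; exact: (near_infty_natSinv_lt (PosNum e0)).
Unshelve. all: by end_near. Qed.

(** Polarization recovers the inner product from the norm alone, which makes its continuity
    immediate. *)
Definition polar (x y : H) : R := (`|x + y| ^+ 2 - `|x - y| ^+ 2) / 4.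

Lemma polar_embed p q : polar (embed p) (embed q) = B p q.
Proof.
rewrite /polar; have -> : embed p + embed q = embed (pre_comb 1 p q).
  by rewrite embed_comb scale1r.
have -> : embed p - embed q = embed (pre_comb (-1) q p).
  by rewrite embed_comb scaleN1r addrC.
rewrite !norm_embed !sqr_pre_norm.
rewrite !pre_form_comb !pre_form_combr (pre_formC q p).
by field.
Qed.

Lemma polar_cvg (f g : nat -> H) x y :
  f n @[n --> \oo] --> x -> g n @[n --> \oo] --> y ->
  polar (f n) (g n) @[n --> \oo] --> polar x y.
Proof.
move=> fx gy; apply: cvgM; last exact: cvg_cst.
rewrite ![`|x + y| ^+ 2]expr2 [`|x - y| ^+ 2]expr2.
under eq_fun do rewrite !expr2.
apply: cvgB.
  by apply: cvgM; apply: cvg_norm; exact: cvgD.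
by apply: cvgM; apply: cvg_norm; exact: cvgB.
Qed.

Lemma polarC x y : polar x y = polar y x.
Proof. rewrite /polar [x + y]addrC distrC; exact: erefl. Qed.

(** On embedded points this is linearity of the form; density and continuity of [polar] extend it to
    the completion. *)
Lemma polar_comb a x y z : polar (a *: x + y) z = a * polar x z + polar y z.
Proof.
have [p px] := embed_cvg x; have [q qy] := embed_cvg y.
have [r rz] := embed_cvg z.
apply: (@cvg_unique _ (@Rhausdorff R)
  (polar (a *: embed (p n) + embed (q n)) (embed (r n)) @[n --> \oo])).
  by apply: polar_cvg rz; apply: cvgD qy; apply: cvgZ px; exact: cvg_cst.
have -> : (fun n => polar (a *: embed (p n) + embed (q n)) (embed (r n))) =
    (fun n => a * polar (embed (p n)) (embed (r n))
              + polar (embed (q n)) (embed (r n))).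
  by apply/funext => n; rewrite -embed_comb !polar_embed pre_form_comb.
by apply: cvgD; [apply: cvgM; first exact: cvg_cst|]; exact: polar_cvg.
Qed.

Lemma polarxx x : polar x x = `|x| ^+ 2.
Proof.
rewrite /polar subrr normr0 -mulr2n -scaler_nat normrZ ger0_norm //.
by field.
Qed.

End CompletionInner.

Section CompletionHilbert.
Context (R : realType) (P : prehilbert R).
Local Notation H := (completion P).
Local Notation dot := (@polar R P : H -> H -> R).

Let bilin : bilinear_for (GRing.Scale.Law.clone _ _ *%R _)
  (GRing.Scale.Law.clone _ _ (idfun \; *%R) _) dot.
Proof.
split=> z a x y; first exact: polar_comb.
by rewrite !(polarC z); exact: polar_comb.
Qed.
HB.instance Definition _ := @bilinear_isBilinear.Build R H H R _ _ dot bilin.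

Let herm (x y : H) : dot x y = (-1) ^+ false * idfun (dot y x).
Proof. by rewrite expr0 mul1r /= polarC. Qed.
HB.instance Definition _ :=
  @isHermitianSesquilinear.Build R H false idfun dot herm.

Let dot_gt0 (x : H) : x != 0 -> 0 < dot x x.
Proof. by move=> x0; rewrite polarxx exprn_gt0 // normr_gt0. Qed.
HB.instance Definition _ := @isDotProduct.Build R H dot dot_gt0.

HB.instance Definition _ :=
  @CompleteNormedModule_isHilbert.Build R H dot (@polarxx R P).
End CompletionHilbert.

Lemma completionP (R : realType) (P : prehilbert R) :
  exists (H : hilbertType R) (f : P -> H),
    forall p q, inner (f p) (f q) = pre_form p q.
Proof. by exists (completion P), (@embed R P) => p q; exact: polar_embed. Qed.

(** * Inner product calculus and finite orthonormal systems *)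

Section InnerProduct.
Context {R : realType} {V : hilbertType R}.
Implicit Types x y z : V.

Lemma innerC x y : inner x y = inner y x.
Proof. by have := hermC (@inner R V) x y; rewrite expr0 mul1r. Qed.

Lemma innerDl x y z : inner (x + y) z = inner x z + inner y z.
Proof. exact: linearDl. Qed.

Lemma innerZl a x z : inner (a *: x) z = a * inner x z.
Proof. exact: linearZl_LR. Qed.

Lemma innerDr x y z : inner z (x + y) = inner z x + inner z y.
Proof. by rewrite innerC innerDl !(innerC z). Qed.

Lemma innerZr a x z : inner z (a *: x) = a * inner z x.
Proof. by rewrite innerC innerZl (innerC z). Qed.

Lemma innerNl x z : inner (- x) z = - inner x z.
Proof. by rewrite -scaleN1r innerZl mulN1r. Qed.

Lemma innerNr x z : inner z (- x) = - inner z x.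
Proof. by rewrite innerC innerNl (innerC z). Qed.

Lemma inner0l z : inner 0 z = 0.
Proof. by rewrite -(scale0r z) innerZl mul0r. Qed.

Lemma inner0r z : inner z 0 = 0.
Proof. by rewrite innerC inner0l. Qed.

Definition innerE :=
  (innerDl, innerDr, innerZl, innerZr, innerNl, innerNr, inner0l, inner0r).

Lemma inner_suml I (r : seq I) (F : I -> V) z :
  inner (\sum_(i <- r) F i) z = \sum_(i <- r) inner (F i) z.
Proof.
apply: (big_morph (fun x => inner x z)) => [x y|]; first exact: innerDl.
exact: inner0l.
Qed.

Lemma sqr_normB x y : `|x - y| ^+ 2 = `|x| ^+ 2 + `|y| ^+ 2 - 2 * inner x y.
Proof. by rewrite -!inner_norm !innerE (innerC y x); ring. Qed.

Lemma sqr_normD x y : `|x + y| ^+ 2 = `|x| ^+ 2 + `|y| ^+ 2 + 2 * inner x y.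
Proof. by rewrite -!inner_norm !innerE (innerC y x); ring. Qed.

Lemma inner_CauchySchwarz x y : `|inner x y| <= `|x| * `|y|.
Proof.
have [->|y0] := eqVneq y 0; first by rewrite inner0r !normr0 mulr0.
have {}y0 : 0 < `|y| by rewrite normr_gt0.
rewrite -(@ler_pXn2r _ 2) ?nnegrE ?mulr_ge0 // exprMn real_normK ?num_real //.
(* This vector is [|y|^2] times the component of [x] orthogonal to [y]. *)
have := sqr_ge0 `| `|y| ^+ 2 *: x - inner x y *: y|.
rewrite -inner_norm !innerE (innerC y x) !inner_norm.
have : 0 < `|y| ^+ 2 by rewrite exprn_gt0.
by nra.
Qed.

(* Gram--Schmidt, recorded only through the Parseval identity that the
   resulting orthonormal system satisfies on the span of [s]. *)
Lemma finite_Parseval (s : seq V) : exists E : seq V,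
  forall x, x \in s ++ E -> forall y,
    inner x y = \sum_(e <- E) inner x e * inner y e.
Proof.
elim: s => [|x s [E HE]]; first by exists [::].
(* The residue of [x] after projection to the span of [E]: if it vanishes, [E] already serves for
   [x]; otherwise its normalisation is added to [E]. *)
pose r := x - \sum_(e <- E) inner x e *: e.
have sumr y : inner (\sum_(e <- E) inner x e *: e) y =
    \sum_(e <- E) inner x e * inner y e.
  by rewrite inner_suml; apply: eq_bigr => e _; rewrite innerZl (innerC e).
have rE z : z \in s ++ E -> inner z r = 0.
  move=> /HE Hz; rewrite innerC innerDl innerNl sumr (innerC x) Hz.
  by apply/eqP; rewrite subr_eq0; apply/eqP/eq_bigr => e _; rewrite mulrC.
have xE : x = r + \sum_(e <- E) inner x e *: e by rewrite subrK.
have sumr0 : inner (\sum_(e <- E) inner x e *: e) r = 0.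
  rewrite sumr big_seq big1 // => e eE; rewrite (innerC r) rE ?mulr0 //.
  by rewrite mem_cat eE orbT.
have [r0|r0] := eqVneq r 0.
  exists E => z; rewrite inE => /predU1P[-> y|]; last exact: HE.
  by rewrite {1}xE r0 add0r sumr.
have nr : `|r| != 0 by rewrite normr_eq0.
pose f := `|r|^-1 *: r.
have ff : inner f f = 1 by rewrite /f innerZl innerZr inner_norm; field.
have fE z : z \in s ++ E -> inner z f = 0.
  by move=> zE; rewrite innerZr rE ?mulr0.
exists (f :: E) => z zfE y; rewrite big_cons.
have {zfE} : [\/ z = x, z = f | z \in s ++ E].
  move: zfE; rewrite !mem_cat !inE => /orP[/predU1P[->|zs]|/predU1P[->|zE]].
  - exact: Or31.
  - by apply: Or33; rewrite zs.
  - exact: Or32.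
  - by apply: Or33; rewrite zE orbT.
case=> [->|->|zE].
- rewrite {1}xE innerDl sumr; congr (_ + _).
  rewrite /f !innerZr {1}xE innerDl sumr0 addr0 inner_norm (innerC y).
  by field.
- rewrite ff mul1r (innerC y) big_seq big1 ?addr0 // => e eE.
  by rewrite (innerC f) fE ?mul0r // mem_cat eE orbT.
- by rewrite fE // mul0r add0r HE.
Qed.

End InnerProduct.

(** * Hilbert space generated by a positive semidefinite kernel *)

Section KernelSpace.
Context (R : realType) (X : Type) (K : X -> X -> R).
Hypothesis KC : forall x y, K x y = K y x.
Hypothesis K_ge0 : forall s : seq (R * X),
  0 <= \sum_(p <- s) \sum_(q <- s) p.1 * q.1 * K p.2 q.2.

Lemma kernel_embedding : exists (H : hilbertType R) (f : X -> H),
  forall x y, inner (f x) (f y) = K x y.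
Proof.
(* A list of pairs (coefficient, point) stands for a formal linear combination of points. *)
pose form (s t : seq (R * X)) :=
  \sum_(p <- s) \sum_(q <- t) p.1 * q.1 * K p.2 q.2.
pose comb a (s t : seq (R * X)) := [seq (a * p.1, p.2) | p <- s] ++ t.
have form0 t : form [::] t = 0 by rewrite /form big_nil.
have form_comb a s t u : form (comb a s t) u = a * form s u + form t u.
  rewrite /form /comb big_cat big_map mulr_sumr /=; congr (_ + _).
  apply: eq_bigr => p _; rewrite mulr_sumr; apply: eq_bigr => q _.
  by rewrite !mulrA.
have formC s t : form s t = form t s.
  rewrite /form exchange_big /=; apply: eq_bigr => p _.
  by apply: eq_bigr => q _; rewrite KC (mulrC q.1).
have [H [f fE]] := completionP (Prehilbert form0 form_comb formC K_ge0).
exists H, (fun x => f [:: (1, x)]) => x y.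
by rewrite fE /= /form !big_seq1 /= !mul1r.
Qed.

End KernelSpace.

(** * Upper bound: the normalised Veronese map *)

Section ConeKernel.
Context {R : realType} (V : hilbertType R).

(* The kernel of the normalised Veronese map [x |-> x (x) x / |x|]; at [0] the
   junk value [0^-1 = 0] gives the intended [0]. *)
Definition veronese_kernel (x y : V) : R := inner x y ^+ 2 / (`|x| * `|y|).

(** In coordinates of an orthonormal system for the points of [s], the double sum is the squared
    Hilbert--Schmidt norm of the combination of the tensors x (x) x / |x|, hence a sum of
    squares. *)
Lemma veronese_kernel_ge0 (s : seq (R * V)) :
  0 <= \sum_(p <- s) \sum_(q <- s) p.1 * q.1 * veronese_kernel p.2 q.2.
Proof.
have [E HE] := finite_Parseval [seq p.2 | p <- s].
pose c (p : R * V) e e' := p.1 / `|p.2| * inner p.2 e * inner p.2 e'.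
suff -> : \sum_(p <- s) \sum_(q <- s) p.1 * q.1 * veronese_kernel p.2 q.2 =
    \sum_(e <- E) \sum_(e' <- E) (\sum_(p <- s) c p e e') ^+ 2.
  by apply: sumr_ge0 => e _; apply: sumr_ge0 => e' _; exact: sqr_ge0.
have -> : \sum_(e <- E) \sum_(e' <- E) (\sum_(p <- s) c p e e') ^+ 2 =
    \sum_(e <- E) \sum_(e' <- E)
      \sum_(p <- s) \sum_(q <- s) c p e e' * c q e e'.
  apply: eq_bigr => e _; apply: eq_bigr => e' _; rewrite expr2 mulr_suml.
  by apply: eq_bigr => p _; rewrite mulr_sumr.
under [RHS]eq_bigr do rewrite exchange_big.
rewrite [RHS]exchange_big big_seq [RHS]big_seq; apply: eq_bigr => p ps.
under [RHS]eq_bigr do rewrite exchange_big.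
rewrite [RHS]exchange_big; apply: eq_bigr => q _ /=.
have pE : p.2 \in [seq p.2 | p <- s] ++ E by rewrite mem_cat map_f.
rewrite /veronese_kernel expr2 {1}(HE _ pE) (HE _ pE).
rewrite invfM mulr_suml mulr_suml mulr_sumr; apply: eq_bigr => e _.
rewrite mulr_sumr mulr_suml mulr_sumr; apply: eq_bigr => e' _.
by rewrite /c; ring.
Qed.

(** Put a = |x|, b = |y|, z = |<x,y>| and w = z^2 / (ab). Then d2 = a^2 + b^2 - 2z and e2 = a^2 +
    b^2 - 2w. The lower bound is w <= z, which is Cauchy--Schwarz; the upper one follows from 2 d2 -
    e2 = (a - b)^2 + 2 (ab + w - 2z), where ab (ab + w - 2z) = (ab - z)^2. *)
Lemma veronese_distortion (x y : V) :
  let d2 := Num.min `|x - y| `|x + y| ^+ 2 in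
  let e2 := veronese_kernel x x + veronese_kernel y y
            - 2 * veronese_kernel x y in
  d2 <= e2 <= 2 * d2.
Proof.
have Kxx z : veronese_kernel z z = `|z| ^+ 2.
  rewrite /veronese_kernel inner_norm; have [->|z0] := eqVneq z 0.
    by rewrite normr0 !expr0n mul0r.
  by field; rewrite normr_eq0.
have -> : Num.min `|x - y| `|x + y| ^+ 2 =
    `|x| ^+ 2 + `|y| ^+ 2 - 2 * `|inner x y|.
  have xy : (`|x - y| <= `|x + y|) = (0 <= inner x y).
    rewrite -ler_sqr ?nnegrE // sqr_normB sqr_normD; lra.
  rewrite minEle xy; case: (ger0P (inner x y)) => _.
    by rewrite sqr_normB.
  by rewrite sqr_normD mulrN opprK.
rewrite /= !Kxx /veronese_kernel -(real_normK (num_real (inner x y))).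
have := inner_CauchySchwarz x y.
set a := `|x|; set b := `|y|; set z := `|inner x y|.
have a0 : 0 <= a := normr_ge0 x; have b0 : 0 <= b := normr_ge0 y.
have z0 : 0 <= z := normr_ge0 (inner x y).
(* If ab = 0, then z = 0 and the kernel term is 0 as well. *)
have := mulr_ge0 a0 b0; rewrite le_eqVlt => /predU1P[<- ze|ab0 zab].
  have -> : z = 0 by lra.
  by rewrite expr0n mul0r; have := sqr_ge0 a; have := sqr_ge0 b; lra.
have wE : z ^+ 2 = z ^+ 2 / (a * b) * (a * b) by rewrite divfK // gt_eqF.
move: wE; set w := z ^+ 2 / _ => wE.
have wz : w <= z by rewrite -(ler_pM2r ab0) -wE expr2 ler_wpM2l.
have wab : 0 <= a * b + w - 2 * z.
  rewrite -(pmulr_lge0 _ ab0) mulrBl mulrDl -wE.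
  by have := sqr_ge0 (a * b - z); lra.
by apply/andP; split; have := sqr_ge0 (a - b); lra.
Qed.
End ConeKernel.

Lemma sign_quotient_embedding (R : realType) (V : hilbertType R) :
  exists (H : hilbertType R) (f : sign_quotient V -> H),
    has_distortion_le f (Num.sqrt 2).
Proof.
have KC (x y : V) : veronese_kernel x y = veronese_kernel y x.
  by rewrite /veronese_kernel innerC (mulrC `|x|).
have [H [f fE]] := kernel_embedding KC (@veronese_kernel_ge0 R V).
(* The distance on the quotient is itself computed at the representatives, so the estimate for
   vectors applies directly, with [alpha = 1]. *)
exists H, (fun p => f (repr p)), 1 => // p q; rewrite mul1r mulr1.
have /= := veronese_distortion (repr p) (repr q).
rewrite -!fE !inner_norm -sqr_normB -[Num.min _ _]/(mdist p q).
have d0 : 0 <= mdist p q by exact: mdist_ge0.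
move=> /andP[lo hi]; apply/andP; split.
  by rewrite -ler_sqr ?nnegrE.
by rewrite -ler_sqr ?nnegrE ?mulr_ge0 ?sqrtr_ge0 // exprMn sqr_sqrtr.
Qed.

(** * Sharp Wirtinger inequality for antiperiodic sequences *)

Lemma dyadic_pihalf (R : realType) i : 0 < (pi : R) / 2 ^+ i.+2 < (pi : R) / 2.
Proof.
have pi0 := pi_gt0 R.
rewrite divr_gt0 ?exprn_gt0 //= ltr_pM2l // ltf_pV2 ?posrE ?exprn_gt0 //.
by rewrite -[ltLHS]expr1 ltr_eXn2l // ltr1n.
Qed.

Lemma cos_dyadic_gt0 (R : realType) i : 0 < cos (pi / 2 ^+ i.+2) :> R.
Proof.
have /andP[lo hi] := dyadic_pihalf R i; apply: cos_gt0_pihalf.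
by rewrite hi (lt_trans _ lo) // oppr_lt0 divr_gt0 // pi_gt0.
Qed.

Lemma sum_shift_periodic (A : zmodType) (F : nat -> A) n :
  (forall j, F (j + n)%N = F j) ->
  forall a, \sum_(0 <= j < n) F (j + a)%N = \sum_(0 <= j < n) F j.
Proof.
move=> Fn; elim=> [|a IH].
  by apply: eq_bigr => j _; rewrite addn0.
rewrite -IH; case: n Fn {IH} => [|n] Fn; first by rewrite !big_nil.
rewrite big_nat_recr // [RHS]big_nat_recl //= addrC.
rewrite addnS -addSn (addnC n.+1) Fn; congr (_ + _).
by apply: eq_bigr => j _; rewrite addnS.
Qed.

Section Antiperiodic.
Context {R : realType} {H : hilbertType R} (g : nat -> H) (n : nat).
Hypothesis gn : forall j, g (j + n)%N = - g j.

(** The summand is [n]-periodic in [j], because the two signs from antiperiodicity cancel; the sum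
    is therefore invariant under shifts. *)
Definition autocorrelation m : R := \sum_(0 <= j < n) inner (g j) (g (j + m)%N).
Local Notation C := autocorrelation.

Lemma sum_inner_shift a b :
  \sum_(0 <= j < n) inner (g (j + a)%N) (g (j + (b + a))%N) = C b.
Proof.
have Fn j : inner (g (j + n)%N) (g (j + n + b)%N) = inner (g j) (g (j + b)%N).
  by rewrite (addnAC j n b) !gn innerNl innerNr opprK.
rewrite -[RHS](sum_shift_periodic Fn a).
by apply: eq_bigr => j _; rewrite addnAC addnA.
Qed.

(* Expands [0 <= sum_j |g (j + 2 m) + g j - 2 s g (j + m)|^2]. *)
Lemma autocorrelation_halving m s : 0 < s ->
  C (m + m) <= (2 * s ^+ 2 - 1) * C 0 -> C m <= s * C 0.
Proof.
move=> s0 H2m.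
have H0 a : \sum_(0 <= j < n) inner (g (j + a)%N) (g (j + a)%N) = C 0.
  by rewrite -(sum_inner_shift a 0).
have := sum_inner_shift m m.
under eq_bigr do rewrite innerC.
move=> Hm.
have : 0 <= \sum_(0 <= j < n)
    `|g (j + (m + m))%N + g j - (2 * s) *: g (j + m)%N| ^+ 2.
  by apply: sumr_ge0 => j _; exact: sqr_ge0.
under eq_bigr => j _.
  rewrite -inner_norm.
  have -> : inner (g (j + (m + m))%N + g j - (2 * s) *: g (j + m)%N)
      (g (j + (m + m))%N + g j - (2 * s) *: g (j + m)%N) =
    inner (g (j + (m + m))%N) (g (j + (m + m))%N) +
    inner (g (j + 0)%N) (g (j + 0)%N) +
    4 * s ^+ 2 * inner (g (j + m)%N) (g (j + m)%N) +
    2 * inner (g j) (g (j + (m + m))%N) -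
    4 * s * inner (g (j + (m + m))%N) (g (j + m)%N) -
    4 * s * inner (g j) (g (j + m)%N).
    rewrite addn0 !innerE (innerC (g (j + (m + m))%N) (g j)).
    rewrite (innerC (g (j + m)%N) (g j)).
    by rewrite (innerC (g (j + m)%N) (g (j + (m + m))%N)); ring.
  over.
rewrite !big_split !sumrN -!mulr_sumr !H0 Hm /= -!/(C _) => ge0.
(* The expansion reads 0 <= (2 + 4 s^2) C 0 + 2 C (2m) - 8 s C m, and the hypothesis bounds 2 C (2m)
   by (4 s^2 - 2) C 0. *)
have : 8 * s * C m <= 8 * s * (s * C 0) by nra.
by rewrite ler_pM2l // mulr_gt0.
Qed.

(** Shifting by half an antiperiod turns [C m] into its negative. *)
Lemma autocorrelation_half m : n = (m + m)%N -> C m = 0.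
Proof.
move=> nE; have := sum_inner_shift m m; rewrite -nE.
under eq_bigr do rewrite gn innerNr innerC.
by rewrite sumrN -/(C m) => Cm; lra.
Qed.

(** The angle is pi m / n. Induction starts at the quarter turn, where [C m = 0], and halves the
    angle: with s the cosine of the half angle, 2 s^2 - 1 is the cosine of the full one. *)
Lemma autocorrelation_cos i m : n = (m * 2 ^ i.+1)%N ->
  C m <= cos (pi / 2 ^+ i.+1) * C 0.
Proof.
elim: i m => [|i IH] m nE.
  by rewrite expr1 cos_pihalf mul0r autocorrelation_half // nE muln2 addnn.
apply: autocorrelation_halving; first exact: cos_dyadic_gt0.
apply: le_trans (IH (m + m)%N _) _.
  by rewrite nE addnn -muln2 -mulnA -expnS.
have -> : pi / 2 ^+ i.+1 = (pi / 2 ^+ i.+2) *+ 2 :> R.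
  by rewrite -mulr_natr (exprS _ i.+1); field; rewrite expf_neq0.
by rewrite cos_mulr2n mulr_natl.
Qed.

(** Expanding the squares gives [2 * C 0 - 2 * C 1], so this is the cosine bound at [m = 1]. *)
Lemma antiperiodic_Wirtinger i : n = (2 ^ i.+1)%N ->
  2 * (1 - cos (pi / 2 ^+ i.+1)) * \sum_(0 <= j < n) `|g j| ^+ 2 <=
  \sum_(0 <= j < n) `|g (j + 1)%N - g j| ^+ 2.
Proof.
move=> nE; have C0E : \sum_(0 <= j < n) `|g j| ^+ 2 = C 0.
  by apply: eq_bigr => j _; rewrite addn0 inner_norm.
have -> : \sum_(0 <= j < n) `|g (j + 1)%N - g j| ^+ 2 = 2 * C 0 - 2 * C 1.
  under eq_bigr do rewrite sqr_normB innerC -inner_norm.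
  rewrite sumrB big_split /= -mulr_sumr (sum_inner_shift 1 0) C0E -/(C 1).
  by ring.
rewrite C0E; have := @autocorrelation_cos i 1 _; rewrite mul1n => /(_ nE); lra.
Qed.

End Antiperiodic.

(** * Lower bound: the image of a unit circle in the quotient *)

Section Circle.
Context {R : realType} {V : hilbertType R} (e1 e2 : V).
Hypothesis e11 : inner e1 e1 = 1.
Hypothesis e22 : inner e2 e2 = 1.
Hypothesis e12 : inner e1 e2 = 0.

Definition circle (t : R) : V := cos t *: e1 + sin t *: e2.

Lemma inner_circle s t : inner (circle s) (circle t) = cos (s - t).
Proof. by rewrite /circle !innerE (innerC e2) e11 e22 e12 cosB; ring. Qed.

Lemma circleDpi t : circle (t + pi) = - circle t.
Proof. by rewrite /circle cosDpi sinDpi !scaleNr opprD. Qed.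

Lemma sqr_norm_circleB s t : `|circle s - circle t| ^+ 2 = 2 - 2 * cos (s - t).
Proof. by rewrite sqr_normB -!inner_norm !inner_circle !subrr cos0. Qed.

Lemma sqr_norm_circleD s t : `|circle s + circle t| ^+ 2 = 2 + 2 * cos (s - t).
Proof. by rewrite sqr_normD -!inner_norm !inner_circle !subrr cos0. Qed.

Lemma circle_distortion (H : hilbertType R) (f : sign_quotient V -> H) c k :
  1 <= c -> has_distortion_le f c -> 1 + cos (pi / 2 ^+ k.+2) <= c ^+ 2.
Proof.
move=> c1 [alpha alpha0 fc].
(* Here theta = pi / (2n): [n] steps make a quarter turn, which leads to the antipode on the
   quotient circle, and 2n steps make a half turn, which returns to the same orbit. *)
pose n := (2 ^ k.+1)%N; set theta := pi / 2 ^+ k.+2.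
have thetaE m : (m + n)%:R * theta = m%:R * theta + pi / 2.
  rewrite natrD mulrDl; congr (_ + _).
  by rewrite /theta natrX (exprS _ k.+1); field; rewrite expf_neq0.
pose x j := \pi_(sign_quotient V)%qT (circle (j%:R * theta)).
pose F j := f (x j); pose g j := F j - F (j + n)%N.
have F2n j : F (j + n + n)%N = F j.
  congr f; rewrite /x !thetaE -addrA -splitr circleDpi.
  by apply/eqquotP/sign_relP; right; rewrite opprK.
have gn j : g (j + n)%N = - g j by rewrite /g F2n opprB.
have := antiperiodic_Wirtinger gn (erefl n).
(* The angle pi / n in the Wirtinger inequality is 2 theta. *)
have c2 : cos (pi / 2 ^+ k.+1) = 2 * cos theta ^+ 2 - 1.
  rewrite mulr_natl -cos_mulr2n; congr cos.
  by rewrite /theta -mulr_natr (exprS _ k.+1); field; rewrite expf_neq0.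
have ca0 : 0 <= c * alpha.
  by rewrite mulr_ge0 ?(le_trans ler01 c1) ?(ltW alpha0).
have step j :
    `|F (j + 1)%N - F j| ^+ 2 <= (c * alpha) ^+ 2 * (2 - 2 * cos theta).
  have <- : `|circle ((j + 1)%:R * theta) - circle (j%:R * theta)| ^+ 2 =
      2 - 2 * cos theta.
    by rewrite sqr_norm_circleB natrD; congr (2 - 2 * cos _); ring.
  rewrite -exprMn ler_sqr ?nnegrE //; last exact: mulr_ge0.
  have /andP[_ /le_trans] := fc (x (j + 1)%N) (x j).
  apply; rewrite ler_wpM2l //.
  by rewrite mdist_sign_quotient ge_min lexx.
(* A quarter turn gives orthogonal unit vectors, so their sum and difference both have squared norm
   2. *)
have far j : 2 * alpha ^+ 2 <= `|g j| ^+ 2.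
  have /andP[le_g _] := fc (x j) (x (j + n)%N).
  apply: (@le_trans _ _ ((alpha * mdist (x j) (x (j + n)%N)) ^+ 2)); last first.
    by rewrite ler_sqr ?nnegrE ?mulr_ge0 ?(ltW alpha0) ?mdist_ge0.
  rewrite exprMn mulrC ler_wpM2l ?sqr_ge0 // mdist_sign_quotient.
  have cos0 : cos (j%:R * theta - (j + n)%:R * theta) = 0 :> R.
    by rewrite thetaE opprD addrA subrr add0r cosN cos_pihalf.
  rewrite minEle; case: ifP => _.
    by rewrite sqr_norm_circleB cos0; lra.
  by rewrite sqr_norm_circleD cos0; lra.
have close j :
    `|g (j + 1)%N - g j| ^+ 2 <= 4 * ((c * alpha) ^+ 2 * (2 - 2 * cos theta)).
  have -> : g (j + 1)%N - g j =
      (F (j + 1)%N - F j) - (F (j + n + 1)%N - F (j + n)%N).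
    by rewrite /g addnAC !opprD !opprK addrACA.
  set u := _ - F j; set v := _ - F (j + n)%N.
  (* By the parallelogram law, |u - v|^2 <= 2 |u|^2 + 2 |v|^2. *)
  have := step j; have := step (j + n)%N; rewrite -/u -/v.
  have : `|u - v| ^+ 2 + `|u + v| ^+ 2 = 2 * `|u| ^+ 2 + 2 * `|v| ^+ 2.
    by rewrite (sqr_normB u v) (sqr_normD u v); ring.
  by have := sqr_ge0 `|u + v|; lra.
move=> W.
have n0 : 0 < n%:R :> R by rewrite ltr0n expn_gt0.
have lo : n%:R * (2 * alpha ^+ 2) <= \sum_(0 <= j < n) `|g j| ^+ 2.
  rewrite mulr_natl -[X in _ *+ X]subn0 -sumr_const_nat.
  by apply: ler_sum => j _; exact: far.
have hi : \sum_(0 <= j < n) `|g (j + 1)%N - g j| ^+ 2 <=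
    n%:R * (4 * ((c * alpha) ^+ 2 * (2 - 2 * cos theta))).
  rewrite mulr_natl -[X in _ *+ X]subn0 -sumr_const_nat.
  by apply: ler_sum => j _; exact: close.
have ct1 : cos theta < 1.
  have := cos2Dsin2 theta; have := sin_gt0_pihalf (dyadic_pihalf R k).
  by rewrite -/theta; nra.
have ct0 : 0 < cos theta by exact: cos_dyadic_gt0.
rewrite c2 in W.
(* Since 1 - cos (2 theta) = 2 (1 - cos theta) (1 + cos theta), both sides share a positive factor,
   whose cancellation leaves the claim. *)
have : n%:R * (4 * alpha ^+ 2 * (1 - cos theta)) * (2 * (1 + cos theta)) <=
       n%:R * (4 * alpha ^+ 2 * (1 - cos theta)) * (2 * c ^+ 2).
  have : 2 * (1 - (2 * cos theta ^+ 2 - 1)) * (n%:R * (2 * alpha ^+ 2)) <=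
    2 * (1 - (2 * cos theta ^+ 2 - 1)) * \sum_(0 <= j < n) `|g j| ^+ 2.
    by apply: ler_wpM2l => //; nra.
  lra.
rewrite ler_pM2l ?mulr_gt0 ?subr_gt0 ?exprn_gt0 //; lra.
Qed.
End Circle.

(** * Passage to the limit and value of the distortion *)

Lemma cos_dyadic_cvg (R : realType) :
  (cos (pi / 2 ^+ k.+2) : R) @[k --> \oo] --> (1 : R).
Proof.
have dyadic0 : (pi / 2 ^+ k.+2 : R) @[k --> \oo] --> (0 : R).
  rewrite (_ : (fun k => _) = geometric (pi / 4 : R) (2^-1 : R)).
    by apply: cvg_geometric; rewrite ger0_norm ?invr_ge0 // invf_lt1 // ltr1n.
  apply/funext => k; rewrite /geometric /= exprVn !exprS.
  by field; rewrite expf_neq0.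
by have := cvg_comp _ _ dyadic0 (@continuous_cos R 0); rewrite cos0.
Qed.

Lemma orthonormal_pair (R : realType) (V : hilbertType R) : dim_ge 2 V ->
  exists e1 e2 : V, [/\ inner e1 e1 = 1, inner e2 e2 = 1 & inner e1 e2 = 0].
Proof.
move=> [e free]; pose x := e ord0; pose y := e ord_max.
have indep a b : a *: x + b *: y = 0 -> a = 0 /\ b = 0.
  move=> ab0; have H := free (fun i => if i == ord0 then a else b).
  rewrite big_ord_recl big_ord1 /= in H.
  have lE : lift ord0 ord0 = ord_max :> 'I_2 by exact: val_inj.
  rewrite lE in H; have {}H := H ab0.
  by split; [exact: (H ord0) | exact: (H ord_max)].
have x0 : `|x| != 0.
  rewrite normr_eq0; apply/eqP => x0.
  have [] := indep 1 0; first by rewrite scale0r addr0 scale1r.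
  by move/eqP; rewrite oner_eq0.
(* Gram--Schmidt with the denominator cleared; [z = 0] would be a linear relation whose coefficient
   [|x|^2] at [y] is nonzero. *)
pose z := `|x| ^+ 2 *: y - inner x y *: x.
have z0 : `|z| != 0.
  rewrite normr_eq0; apply/eqP => z0.
  have [] := indep (- inner x y) (`|x| ^+ 2); first by rewrite scaleNr addrC.
  by move=> _ /eqP; rewrite sqrf_eq0 (negPf x0).
have xz : inner x z = 0.
  by rewrite /z innerDr innerNr !innerZr inner_norm; ring.
exists (`|x|^-1 *: x), (`|z|^-1 *: z); split.
- by rewrite innerZl innerZr inner_norm; field.
- by rewrite innerZl innerZr inner_norm; field.
- by rewrite innerZl innerZr xz !mulr0.
Qed.

(** The bounds 1 + cos (pi / 2^(k+2)) <= c^2 hold for every k and tend to 2 <= c^2. *)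
Lemma sqrt2_le_distortion (R : realType) (V : hilbertType R) (H : hilbertType R)
    (f : sign_quotient V -> H) c :
  dim_ge 2 V -> 1 <= c -> has_distortion_le f c -> Num.sqrt 2 <= c.
Proof.
move=> /orthonormal_pair[e1 [e2 [e11 e22 e12]]] c1 fc.
have c0 : 0 <= c by exact: le_trans c1.
rewrite -(ger0_norm c0) -sqrtr_sqr ler_sqrt ?sqr_ge0 //.
have cvg2 : (1 + cos (pi / 2 ^+ k.+2) : R) @[k --> \oo] --> (1 + 1 : R).
  by apply: cvgD; [exact: cvg_cst | exact: cos_dyadic_cvg].
rewrite -[leLHS](cvg_lim (@Rhausdorff R) cvg2).
apply: limr_le; first by apply/cvg_ex; exists (1 + 1).
by near=> k; exact: (circle_distortion e11 e22 e12 k c1 fc).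
Unshelve. all: by end_near. Qed.

Theorem corollary36 (R : realType) (V : hilbertType R) (dimV : dim_ge 2 V) :
  euclidean_distortion (sign_quotient V) = (Num.sqrt 2 : R)%:E.
Proof.
apply/eqP; rewrite eq_le; apply/andP; split.
  (* The infimum is attained by the Veronese embedding. *)
  apply: ereal_inf_lbound; exists (Num.sqrt 2) => //; split.
    by rewrite -[leLHS]sqrtr1 ler_sqrt // ler1n.
  exact: sign_quotient_embedding.
apply: le_ereal_inf_tmp => _ [c [c1 [H [f fc]]] <-].
by rewrite lee_fin; exact: sqrt2_le_distortion fc.
Qed.
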